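(* Consider an RBM with observed variables $X\in\{-1,1\}^n$ and latent variables $Y\in\{-1,1\}^m$ as defined in the context, with parameters $d$ and $s$ as defined there. Fix an observed variable $u\in[n]$ and subsets $I,S\subseteq[n]$ such that $\{u\}$, $I$, $S$ are pairwise disjoint. Suppose that $I$ is a subset of the MRF neighborhood of $u$ and that $|I|\le d-1$. Then there exists a subset $I'\subseteq I$ with $|I'|\le 2^s$ such that \[\nu_{u,I'|S}\;\ge\;\frac{1}{(4d)^{2^s}}\left(\frac{1}{d}\right)^{2^s(2^s+1)}\nu_{u,I|S}.\]
   Context: A Restricted Boltzmann Machine (RBM) is a distribution over observed variables $X\in\{-1,1\}^n$ and latent variables $Y\in\{-1,1\}^m$ with $\mathbb{P}(X=x,Y=y)\propto\exp(x^TJy+h^Tx+g^Ty)$, where $J\in\mathbb{R}^{n\times m}$, $h\in\mathbb{R}^n$, $g\in\mathbb{R}^m$. Observed variable $i$ and latent variable $j$ are connected iff $J_{i,j}\neq0$; $d$ is the maximum over $j\in[m]$ of $|\{i: J_{i,j}\ne 0\}|$. The marginal of $X$ satisfies $\mathbb{P}(X=x)\propto\exp(f(x))$ with $f(x)=\sum_{j=1}^m\rho(J_j\cdot x+g_j)+h^Tx$, where $J_j$ is the $j$-th column of $J$ and $\rho(t)=\log(e^t+e^{-t})$. Write $f(x)=\sum_{T\subseteq[n]}\hat f(T)\chi_T(x)$ with $\chi_T(x)=\prod_{i\in T}x_i$ (the unique multilinear expansion). The MRF neighborhood of $u$ is the set of $i\in[n]\setminus\{u\}$ such that $\hat f(T)\ne0$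 for some $T$ with $u,i\in T$. Define $s$ as the maximum over $u\in[n]$ of the number of latent variables $j\in[m]$ such that $J_{i,j}\neq 0$ for some $i$ in the MRF neighborhood of $u$. For disjoint $\{u\},I,S$ and assignments, $\nu_{u,I|S}(x_u,x_I|x_S):=|\mathbb{P}(X_u=x_u,X_I=x_I|X_S=x_S)-\mathbb{P}(X_u=x_u|X_S=x_S)\mathbb{P}(X_I=x_I|X_S=x_S)|$, and $\nu_{u,I|S}:=\mathbb{E}_{R,G}\big[\mathbb{E}_{X_S}[\nu_{u,I|S}(R,G|X_S)]\big]$, where $R$ is uniform on $\{-1,1\}$, $G$ is uniform on $\{-1,1\}^{|I|}$, independent of each other and of $X$, and $X_S$ has the marginal law of the RBM. *)

(* Defs.v *)
From HB Require Import structures.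
From mathcomp Require Import all_boot all_order all_algebra.
From mathcomp Require Import reals.
From mathcomp.analysis Require Import sequences exp.
Set Implicit Arguments. Unset Strict Implicit. Unset Printing Implicit Defensive.
Import Order.TTheory GRing.Theory Num.Theory.
Local Open Scope ring_scope.

Section RBM.
Variables (R : realType) (n m : nat).
Variables (J : 'I_n -> 'I_m -> R) (h : 'I_n -> R) (g : 'I_m -> R).

Definition spin (b : bool) : R := if b then 1 else -1.

Definition obs := {ffun 'I_n -> bool}.
Definition lat := {ffun 'I_m -> bool}.

Definition joint_weight (x : obs) (y : lat) : R :=
  expR (\sum_(i < n) \sum_(j < m) spin (x i) * J i j * spin (y j)
        + \sum_(i < n) h i * spin (x i) + \sum_(j < m) g j * spin (y j)).

Definition partition_fn : R := \sum_(x : obs) \sum_(y : lat) joint_weight x y.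

Definition PX (x : obs) : R := (\sum_(y : lat) joint_weight x y) / partition_fn.

Definition rho (t : R) : R := ln (expR t + expR (- t)).

Definition fRBM (x : obs) : R :=
  \sum_(j < m) rho (\sum_(i < n) J i j * spin (x i) + g j)
  + \sum_(i < n) h i * spin (x i).

Definition chi (T : {set 'I_n}) (x : obs) : R := \prod_(i in T) spin (x i).

(* coefficient of chi_T in the unique multilinear expansion of f *)
Definition fhat (T : {set 'I_n}) : R :=
  (2 ^+ n)^-1 * \sum_(x : obs) fRBM x * chi T x.

Definition mrf_nbhd (u : 'I_n) : {set 'I_n} :=
  [set i | (i != u) && [exists T : {set 'I_n}, [&& u \in T, i \in T & fhat T != 0]]].

Definition dRBM : nat := \max_(j < m) #|[set i | J i j != 0%R]|.

Definition sRBM : nat :=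
  \max_(u < n) #|[set j : 'I_m | [exists i in mrf_nbhd u, J i j != 0%R]]|.

Definition Pagree (A : {set 'I_n}) (x : obs) : R :=
  \sum_(x' : obs | [forall i in A, x' i == x i]) PX x'.

Definition condP (A S : {set 'I_n}) (x : obs) : R :=
  Pagree (A :|: S) x / Pagree S x.

(* nu_{u,I|S}(x_u, x_I | x_S), the assignments read off the full vector x *)
Definition nu_pt (u : 'I_n) (I S : {set 'I_n}) (x : obs) : R :=
  `| condP ([set u] :|: I) S x - condP [set u] S x * condP I S x |.

Definition mix (u : 'I_n) (I : {set 'I_n}) (r : bool) (gv xv : obs) : obs :=
  [ffun i => if i == u then r else if i \in I then gv i else xv i].

(* nu_{u,I|S} = E_{R,G}[E_{X_S}[nu(R,G|X_S)]], R uniform on {-1,1},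
   G uniform on {-1,1}^I (realized as the restriction of a uniform full vector),
   X_S distributed as the RBM marginal (realized as restriction of X ~ PX). *)
Definition nu (u : 'I_n) (I S : {set 'I_n}) : R :=
  \sum_(r : bool) \sum_(gv : obs) \sum_(xv : obs)
     (2^-1 * (2 ^+ n)^-1 * PX xv) * nu_pt u I S (mix u I r gv xv).

End RBM.

(* Main.v *)
Require Import Defs.
From HB Require Import structures.
From mathcomp Require Import all_boot all_order all_algebra.
From mathcomp Require Import reals.
From mathcomp.analysis Require Import sequences exp.
From mathcomp Require Import ring zify.
Import Order.TTheory GRing.Theory Num.Theory.
Local Open Scope ring_scope.

(* Only the latent variables in the set [L] touching the MRF neighborhood of [u]
   (at most [s] of them) act on [X_I], and given their values [y] the spins in [I] are
   independent of each other and of the rest. Hence, for every [B] inside [I],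
   [nu_{u,B|S}(x)] is the absolute value of a mixture [sum_y c_y prod_(i in B) p_i(y)]
   over at most [k = 2^s] values of [y], with weights [c_y] independent of [B] and
   factors [p_i(y)] in [0,1]. Writing [p_i(y) = p_i(y1) + (p_i(y) - p_i(y1))] for one
   [i] removes a factor, the second term giving new weights that vanish at [y1].
   After [k] such recenterings the weights are zero, so the mixture for [I] is
   bounded by those for subsets of size at most [k], with total coefficient
   at most [(2 #|I| + 1)^k <= (4 d)^k]. *)

(** * Mixtures of products and their interpolation *)

Definition mixture_norm {R : realDomainType} {Om V Y : finType}
    (p : Om -> V -> Y -> R) (c : Om -> Y -> R) (B : {set V}) : R :=
  \sum_(o : Om) `|\sum_(y : Y) c o y * \prod_(i in B) p o i y|.

Definition recenter {R : realDomainType} {Om V Y : finType}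
    (p : Om -> V -> Y -> R) (c : Om -> Y -> R) (i : V) (y1 : Y) (o : Om) (y : Y) : R :=
  c o y * (p o i y - p o i y1).

Section MixtureNorm.
Set Implicit Arguments.
Unset Strict Implicit.
Variables (R : realDomainType) (Om V Y : finType) (p : Om -> V -> Y -> R).
Hypothesis p_ge0 : forall o i y, 0 <= p o i y.
Hypothesis p_le1 : forall o i y, p o i y <= 1.
Implicit Types (c : Om -> Y -> R) (i : V) (y : Y) (B : {set V}).

Lemma mixture_norm_ge0 c B : 0 <= mixture_norm p c B.
Proof. by apply: sumr_ge0 => o _; apply: normr_ge0. Qed.

Lemma mixture_norm_split c i y1 (B : {set V}) : i \in B ->
  mixture_norm p c B <=
  mixture_norm p c (B :\ i) + mixture_norm p (recenter p c i y1) (B :\ i).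
Proof.
move=> iB; rewrite /mixture_norm -big_split /=; apply: ler_sum => o _.
have -> : \sum_y c o y * \prod_(j in B) p o j y =
  p o i y1 * (\sum_y c o y * \prod_(j in B :\ i) p o j y)
  + \sum_y recenter p c i y1 o y * \prod_(j in B :\ i) p o j y.
  rewrite mulr_sumr -big_split /=; apply: eq_bigr => y _.
  by rewrite (big_setD1 i iB) /recenter /=; ring.
apply: (le_trans (ler_normD _ _)); rewrite lerD2r normrM ger0_norm//.
by rewrite ler_piMl// normr_ge0.
Qed.

(** The identity behind the split, read backwards: bounds on small sets for [c] pass to the
    recentered weights, at the cost of one more index and a factor 2. *)
Lemma mixture_norm_recenter c i y1 (B : {set V}) : i \notin B ->
  mixture_norm p (recenter p c i y1) B <=
  mixture_norm p c (i |: B) + mixture_norm p c B.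
Proof.
move=> iB; rewrite /mixture_norm -big_split /=; apply: ler_sum => o _.
have -> : \sum_y recenter p c i y1 o y * \prod_(j in B) p o j y =
  (\sum_y c o y * \prod_(j in i |: B) p o j y)
  - p o i y1 * (\sum_y c o y * \prod_(j in B) p o j y).
  rewrite mulr_sumr -sumrB; apply: eq_bigr => y _.
  by rewrite (big_setU1 i iB) /recenter /=; ring.
apply: (le_trans (ler_normB _ _)); rewrite lerD2l normrM ger0_norm//.
by rewrite ler_piMl// normr_ge0.
Qed.

(* Newton interpolation: each recentering at a point of [Z] removes that point
   from the support of the weights, so at most [#|Z|] factors survive. *)
Lemma mixture_norm_interpolation t (I : {set V}) k (Z : {set Y}) c M :
  #|I| = t -> (#|Z| <= k)%N -> (forall o y, y \notin Z -> c o y = 0) ->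
  (forall B : {set V}, B \subset I -> (#|B| <= k)%N -> mixture_norm p c B <= M) ->
  mixture_norm p c I <= (2 * t).+1%:R ^+ k * M.
Proof.
elim: t I k Z c M => [|t IH] I k Z c M cI cZ c0 hM.
  by rewrite muln0 expr1n mul1r hM// cI.
have M0 : 0 <= M.
  by apply: (le_trans (mixture_norm_ge0 c set0)); rewrite hM ?sub0set ?cards0.
have [Z0|[y1 y1Z]] := set_0Vmem Z.
  rewrite /mixture_norm big1 ?mulr_ge0 ?exprn_ge0 ?ler0n// => o _.
  by rewrite big1 ?normr0// => y _; rewrite c0 ?mul0r// Z0 inE.
have [i iI] : exists i, i \in I by apply/card_gt0P; rewrite cI.
have cI0 : #|I :\ i| = t by move: cI; rewrite (cardsD1 i) iI => -[].
case: k cZ hM => [|k] cZ hM.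
  by move: cZ; rewrite leqn0 cards_eq0 => /eqP Z0; rewrite Z0 inE in y1Z.
(* The first term of the split keeps [c], [Z] and [k]; the second lowers [k] by one, removes [y1]
   from [Z] and doubles the bound. *)
have le1 : mixture_norm p c (I :\ i) <= (2 * t).+1%:R ^+ k.+1 * M.
  apply: (IH _ _ Z) => // B BI; apply: hM.
  exact: subset_trans BI (subD1set _ _).
have le2 : mixture_norm p (recenter p c i y1) (I :\ i)
    <= (2 * t).+1%:R ^+ k * (M + M).
  apply: (IH _ _ (Z :\ y1)) => //.
  - by move: cZ; rewrite (cardsD1 y1) y1Z.
  - move=> o y; rewrite !inE negb_and negbK /recenter => /orP[/eqP->|yZ].
      by rewrite subrr mulr0.
    by rewrite c0 ?mul0r.
  - move=> B; rewrite subsetD1 => /andP[BI iB] cB.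
    apply: (le_trans (mixture_norm_recenter c y1 iB)); apply: lerD; apply: hM.
    + by rewrite subUset sub1set iI.
    + by rewrite cardsU1 iB.
    + by [].
    + exact: leqW.
apply: (le_trans (mixture_norm_split c y1 iI)).
apply: (le_trans (lerD le1 le2)).
(* The next coefficient: (2t+1)^(k+1) + 2(2t+1)^k = (2t+3)(2t+1)^k, where 2t+3 = 2(t+1)+1. *)
have -> : (2 * t).+1%:R ^+ k.+1 * M + (2 * t).+1%:R ^+ k * (M + M)
    = (2 * t.+1).+1%:R * (2 * t).+1%:R ^+ k * M :> R.
  by rewrite exprS mulnS !addSn add0n -![_.+3%:R]natr1 -![_.+2%:R]natr1; ring.
rewrite exprS ler_wpM2r// ler_wpM2l ?ler0n// lerXn2r ?nnegrE ?ler0n//.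
by rewrite ler_nat; lia.
Qed.

End MixtureNorm.

(** * Observed spins conditioned on the latent variables *)

Definition latent_field {R : realType} {n m} (J : 'I_n -> 'I_m -> R) (h : 'I_n -> R)
    (y : lat m) (i : 'I_n) : R := \sum_(j < m) J i j * spin R (y j) + h i.

(* P(X_i = z_i | Y = y). *)
Definition obs_prob {R : realType} {n m} (J : 'I_n -> 'I_m -> R) (h : 'I_n -> R)
    (z : obs n) (i : 'I_n) (y : lat m) : R :=
  expR (spin R (z i) * latent_field J h y i)
  / (expR (latent_field J h y i) + expR (- latent_field J h y i)).

(** P(X_A = z_A, Y = y) before division by [partition_fn]. *)
Definition agree_weight {R : realType} {n m} (J : 'I_n -> 'I_m -> R) (h : 'I_n -> R)
    (g : 'I_m -> R) (A : {set 'I_n}) (z : obs n) (y : lat m) : R :=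
  \sum_(x : obs n | [forall i in A, x i == z i]) joint_weight J h g x y.

(* P(X_u = z_u, Y = y | X_S = z_S) - P(X_u = z_u | X_S = z_S) P(Y = y | X_S = z_S). *)
Definition latent_cov {R : realType} {n m} (J : 'I_n -> 'I_m -> R) (h : 'I_n -> R)
    (g : 'I_m -> R) (u : 'I_n) (S : {set 'I_n}) (z : obs n) (y : lat m) : R :=
  (agree_weight J h g (u |: S) z y - condP J h g [set u] S z * agree_weight J h g S z y)
  / partition_fn J h g / Pagree J h g S z.

Definition flip_spin {n} (i : 'I_n) (x : obs n) : obs n :=
  [ffun k => if k == i then ~~ x k else x k].

(** Entries outside [L] default to [false], which picks one representative in [lat m] for each class
    of states agreeing on [L]. *)
Definition restrict_lat {m} (L : {set 'I_m}) (y : lat m) : lat m :=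
  [ffun j => (j \in L) && y j].

Section RBMMixture.
Set Implicit Arguments.
Unset Strict Implicit.
Variables (R : realType) (n m : nat).
Variables (J : 'I_n -> 'I_m -> R) (h : 'I_n -> R) (g : 'I_m -> R).

Lemma obs_prob_ge0 z i y : 0 <= obs_prob J h z i y.
Proof. by rewrite divr_ge0 ?addr_ge0 ?expR_ge0. Qed.

Lemma obs_prob_le1 z i y : obs_prob J h z i y <= 1.
Proof.
rewrite ler_pdivrMr ?addr_gt0 ?expR_gt0// mul1r /spin.
by case: (z i); rewrite ?mul1r ?mulN1r ?lerDl ?lerDr expR_ge0.
Qed.

(** For fixed [y] the exponent is affine in the observed spins, so the spin at [i] factors out. *)
Lemma joint_weight_split x y i :
  joint_weight J h g x y = expR (spin R (x i) * latent_field J h y i) *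
    expR (\sum_(k < n | k != i) spin R (x k) * latent_field J h y k
          + \sum_(j < m) g j * spin R (y j)).
Proof.
rewrite /joint_weight -expRD; congr expR; rewrite addrA; congr (_ + _).
rewrite -big_split (bigD1 i) //=.
have e k : \sum_(j < m) spin R (x k) * J k j * spin R (y j) + h k * spin R (x k)
    = spin R (x k) * latent_field J h y k.
  rewrite mulrDr mulr_sumr (mulrC (h k)); congr (_ + _).
  by apply: eq_bigr => j _; rewrite mulrA.
by rewrite e; congr (_ + _); apply: eq_bigr => k _; rewrite e.
Qed.

Lemma flip_spinK (i : 'I_n) : involutive (flip_spin i).
Proof. by move=> x; apply/ffunP => k; rewrite !ffunE; case: eqP; rewrite ?negbK. Qed.

(* Given [y], the spin at [i] is independent of all other observed spins. *)
Lemma agree_weightU1 (A : {set 'I_n}) z y i : i \notin A ->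
  agree_weight J h g (i |: A) z y = obs_prob J h z i y * agree_weight J h g A z y.
Proof.
move=> iA.
have agU (x : obs n) : [forall k in i |: A, x k == z k] =
    [forall k in A, x k == z k] && (x i == z i).
  apply/forall_inP/andP => [H|[/forall_inP H xi] k].
    split; last by rewrite H ?setU11.
    by apply/forall_inP => k kA; rewrite H// setU1r.
  by rewrite in_setU1 => /orP[/eqP->|/H].
have agF (x : obs n) :
    [forall k in A, flip_spin i x k == z k] = [forall k in A, x k == z k].
  apply: eq_forallb_in => k kA; rewrite ffunE; case: (k =P i) => // ki.
  by rewrite -ki kA in iA.
rewrite /agree_weight [in RHS](bigID (fun x : obs n => x i == z i)) /=.
(* Flipping the spin at [i] carries the states with x_i <> z_i onto those with x_i = z_i, so the two
   halves add term by term. *)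
rewrite [X in _ * (_ + X)](reindex_inj (inv_inj (flip_spinK i))) /=.
rewrite (eq_bigl _ _ agU).
rewrite [X in _ * (_ + X)](eq_bigl
    (fun x : obs n => [forall k in A, x k == z k] && (x i == z i))); last first.
  by move=> x; rewrite agF ffunE eqxx; case: (x i) (z i) => [] [].
rewrite -big_split mulr_sumr /=; apply: eq_bigr => x /andP[_ /eqP xi].
rewrite !(joint_weight_split _ y i) ffunE eqxx xi.
set r := \sum_(k < n | k != i) _; set r' := \sum_(k < n | k != i) _.
have -> : r' = r by apply: eq_bigr => k /negbTE ki; rewrite ffunE ki.
have s_neq0 : expR (latent_field J h y i) + expR (- latent_field J h y i) != 0.
  by rewrite gt_eqF// addr_gt0 ?expR_gt0.
rewrite -mulrDl mulrA; congr (_ * _); rewrite /obs_prob.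
have -> : expR (spin R (z i) * latent_field J h y i)
      + expR (spin R (~~ z i) * latent_field J h y i)
    = expR (latent_field J h y i) + expR (- latent_field J h y i).
  by rewrite /spin; case: (z i); rewrite /= ?mul1r ?mulN1r// addrC.
by rewrite divfK.
Qed.

Lemma agree_weightU (B A : {set 'I_n}) z y : [disjoint B & A] ->
  agree_weight J h g (B :|: A) z y =
  (\prod_(i in B) obs_prob J h z i y) * agree_weight J h g A z y.
Proof.
move: {2}#|B| (erefl #|B|) => t; elim: t B => [|t IH] B cB dBA.
  by move/eqP: cB; rewrite cards_eq0 => /eqP->; rewrite set0U big_set0 mul1r.
have [i iB] : exists i, i \in B by apply/card_gt0P; rewrite cB.
have cB1 : #|B :\ i| = t by move: cB; rewrite (cardsD1 i) iB => -[].
rewrite (big_setD1 i iB) /= -{1}(setD1K iB) -setUA agree_weightU1; last first.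
  by rewrite !inE eqxx /= (disjointFr dBA iB).
by rewrite IH ?mulrA//; apply: disjointWl dBA; apply: subD1set.
Qed.

Lemma PagreeE A z : Pagree J h g A z =
  (\sum_(y : lat m) agree_weight J h g A z y) / partition_fn J h g.
Proof.
by rewrite /Pagree /PX -mulr_suml /agree_weight exchange_big.
Qed.

Lemma eq_Pagree (A : {set 'I_n}) (z z' : obs n) : {in A, z =1 z'} ->
  Pagree J h g A z = Pagree J h g A z'.
Proof.
by move=> e; apply: eq_bigl => x; apply: eq_forallb_in => i /e->.
Qed.

Lemma eq_nu_pt u (B S : {set 'I_n}) (z z' : obs n) : {in u |: (B :|: S), z =1 z'} ->
  nu_pt J h g u B S z = nu_pt J h g u B S z'.
Proof.
by move=> e; rewrite /nu_pt /condP; congr `| _ / _ - _ / _ * (_ / _)|;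
  apply: eq_Pagree => i; rewrite ?inE => iA; apply: e; rewrite !inE;
  move: iA; do ?case: (_ == _); do ?case: (_ \in _).
Qed.

(** Both probabilities involving X_B expand over [y] with the same product over [B]; the rest
    collects into [latent_cov]. *)
Lemma nu_ptE u (B S : {set 'I_n}) z : u \notin B -> [disjoint B & S] ->
  nu_pt J h g u B S z =
  `|\sum_(y : lat m) latent_cov J h g u S z y * \prod_(i in B) obs_prob J h z i y|.
Proof.
move=> uB dBS; have dBuS : [disjoint B & u |: S].
  by rewrite disjoint_sym disjoints_subset subUset sub1set -disjoints_subset
    inE uB disjoint_sym.
rewrite /nu_pt; congr `| _ |.
rewrite {1}/condP -setUA setUCA PagreeE {2}/condP.
rewrite [Pagree _ _ _ (B :|: S) _]PagreeE.
under eq_bigr do rewrite agree_weightU//.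
under [X in _ - _ * (X / _ / _)]eq_bigr do rewrite agree_weightU//.
rewrite !mulr_suml mulr_sumr -sumrB; apply: eq_bigr => y _.
by rewrite /latent_cov; ring.
Qed.

Lemma obs_prob_restrict (L : {set 'I_m}) z i y :
  (forall j, J i j != 0 -> j \in L) ->
  obs_prob J h z i (restrict_lat L y) = obs_prob J h z i y.
Proof.
move=> JL; rewrite /obs_prob.
suff -> : latent_field J h (restrict_lat L y) i = latent_field J h y i by [].
congr (_ + _); apply: eq_bigr => j _; rewrite ffunE.
by have [->|/JL->//] := eqVneq (J i j) 0; rewrite !mul0r.
Qed.

Lemma card_restrict_lat (L : {set 'I_m}) :
  (#|[set restrict_lat L y | y : lat m]| <= 2 ^ #|L|)%N.
Proof.
rewrite -card_bool -(card_pffun_on false); apply: subset_leq_card.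
apply/subsetP => _ /imsetP[y _ ->]; apply/pffun_onP; split=> //.
by apply/subsetP => j; rewrite !inE ffunE; case: (j \in L).
Qed.

Lemma PX_ge0 x : 0 <= PX J h g x.
Proof.
by rewrite divr_ge0// ?sumr_ge0// => *; rewrite ?sumr_ge0// => *; apply: expR_ge0.
Qed.

(** The factors for [I] see [y] only through its restriction to [L], so states with equal
    restriction are merged. Building [z] from [I] rather than [B] gives all [B] the same weights and
    factors. *)
Lemma nu_mixture_norm u (I S : {set 'I_n}) (L : {set 'I_m}) :
  u \notin I -> [disjoint I & S] ->
  (forall i j, i \in I -> J i j != 0 -> j \in L) ->
  let z (o : bool * obs n * obs n) := mix u I o.1.1 o.1.2 o.2 in
  let c o (y' : lat m) := 2^-1 * (2 ^+ n)^-1 * PX J h g o.2 *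
    \sum_(y : lat m | restrict_lat L y == y') latent_cov J h g u S (z o) y in
  forall B : {set 'I_n}, B \subset I ->
  nu J h g u B S = mixture_norm (fun o => obs_prob J h (z o)) c B.
Proof.
move=> uI dIS JL z c B BI.
rewrite /nu /mixture_norm pair_big pair_big /=; apply: eq_bigr => -[[r gv] xv] _ /=.
have uB : u \notin B by apply: contra uI; apply: (subsetP BI).
have dBS : [disjoint B & S] by apply: disjointWl dIS.
rewrite (@eq_nu_pt _ _ _ _ (z (r, gv, xv))); last first.
  move=> i; rewrite !inE !ffunE /=; case: eqP => //= _ /orP[iB|iS].
    by rewrite iB (subsetP BI).
  by rewrite (disjointFl dBS iS) (disjointFl dIS iS).
rewrite nu_ptE// /c /=; set w := 2^-1 * _ * _.
have w0 : 0 <= w by rewrite mulr_ge0 ?PX_ge0// mulr_ge0 ?invr_ge0 ?exprn_ge0.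
under [in RHS]eq_bigr do rewrite -mulrA.
rewrite -mulr_sumr normrM (ger0_norm w0); congr (_ * `| _ |).
rewrite (partition_big (restrict_lat L) xpredT) //=; apply: eq_bigr => y' _.
rewrite mulr_suml; apply: eq_bigr => y /eqP <-; congr (_ * _).
apply: eq_bigr => i iB; rewrite obs_prob_restrict// => j.
by apply: JL; apply: (subsetP BI).
Qed.

End RBMMixture.

Theorem theorem2 (R : realType) (n m : nat)
  (J : 'I_n -> 'I_m -> R) (h : 'I_n -> R) (g : 'I_m -> R)
  (u : 'I_n) (I S : {set 'I_n}) :
  u \notin I -> u \notin S -> [disjoint I & S] ->
  I \subset mrf_nbhd J h g u ->
  (#|I|.+1 <= dRBM J)%N ->
  exists I' : {set 'I_n},
    [/\ I' \subset I, (#|I'| <= 2 ^ sRBM J h g)%N &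
     ((4 * dRBM J)%:R ^+ (2 ^ sRBM J h g))^-1
       * ((dRBM J)%:R^-1) ^+ (2 ^ sRBM J h g * (2 ^ sRBM J h g).+1)
       * nu J h g u I S
     <= nu J h g u I' S].
Proof.
move=> uI _ dIS IN dI.
pose L := [set j : 'I_m | [exists i in mrf_nbhd J h g u, J i j != 0%R]].
have JL i j : i \in I -> J i j != 0 -> j \in L.
  by move=> iI Jij; rewrite inE; apply/exists_inP; exists i => //; apply: (subsetP IN).
have Ls : (2 ^ #|L| <= 2 ^ sRBM J h g)%N.
  by rewrite leq_exp2l// /sRBM; apply: (leq_bigmax u).
set k := (2 ^ sRBM J h g)%N in Ls *; set d := dRBM J in dI *.
pose P (B : {set 'I_n}) := (B \subset I) && (#|B| <= k)%N.
have P0 : P set0 by rewrite /P sub0set cards0.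
(* [I'] maximizes [nu] among the subsets of [I] of size at most [k], so its value can serve as the
   bound [M]. *)
have [I' /andP[I'I cI'] maxI'] := @arg_maxP _ _ _ _ P (fun B => nu J h g u B S) P0.
exists I'; split=> //.
have nuE := nu_mixture_norm h g uI dIS JL.
have main : nu J h g u I S <= (2 * #|I|).+1%:R ^+ k * nu J h g u I' S.
  rewrite (nuE I)//; apply: (mixture_norm_interpolation _ _ erefl
      (leq_trans (card_restrict_lat L) Ls)).
  - by move=> o i y; apply: obs_prob_ge0.
  - by move=> o i y; apply: obs_prob_le1.
  (* Off the image of [restrict_lat L] a merged weight is an empty sum. *)
  - move=> o y' yZ; rewrite big1 ?mulr0// => y /eqP e.
    by rewrite -e imset_f in yZ.
  - by move=> B BI cB; rewrite -nuE//; apply: maxI'; rewrite /P BI.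
have nu0 : 0 <= nu J h g u I' S by rewrite nuE// mixture_norm_ge0.
have d0 : (0 < d)%N by lia.
rewrite -mulrA [X in _ * X <= _]mulrC -ler_pdivlMl ?invr_gt0 ?exprn_gt0 ?ltr0n//;
  last by lia.
(* The power of 1/d is at most 1 because d >= 1. *)
rewrite invrK; apply: (@le_trans _ _ (nu J h g u I S)).
  rewrite ler_piMr//; first by rewrite nuE// mixture_norm_ge0.
  by rewrite exprn_ile1 ?invr_ge0 ?ler0n// invf_le1 ?ler1n ?ltr0n.
apply: (le_trans main); rewrite ler_wpM2r// lerXn2r ?nnegrE ?ler0n//.
by rewrite ler_nat; lia.
Qed.
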